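(* Let $\mathbf{INF}^\iota$ be the natural deduction system described in the context. For any deduction $\Pi$ in $\mathbf{INF}^\iota$ of a formula $A$ from a set of undischarged assumptions $\Gamma$, there is a deduction in $\mathbf{INF}^\iota$ of $A$ whose undischarged assumptions are among the formulas in $\Gamma$ and which is in normal form.
   Context: Language: first-order formulas built from atomic formulas (predicate letters applied to terms, identities $t_1=t_2$, formulas $\exists! t$ read ''$t$ exists'', and $\bot$), using $\land,\lor,\rightarrow$, the quantifiers $\forall x,\exists x$, and a binary quantifier $\iota$: if $F,G$ are formulas and $x$ a variable, $\iota x[F,G]$ is a formula (''The $F$ is $G$'') binding $x$ in $F$ and $G$. Terms may be built with function letters. $A_t^x$ is the result of substituting $t$ for the free occurrences of $x$ in $A$, where $t$ is free for $x$ in $A$ (no variable of $t$ becomes bound). The system $\mathbf{INF}^\iota$ (intuitionist negative free logic with $\iota$) has the following rules (in natural deduction, assumptions may be discharged, marked by $[\ ]$). Propositional: $\land I$: from $A,B$ infer $A\land B$; $\land E$: from $A\land B$ infer $A$, and infer $B$; $\rightarrow I$: from a deduction of $B$ from $[A]$ infer $A\rightarrow B$ discharging $A$; $\rightarrow E$: from $A\rightarrow B$ and $A$ infer $B$; $\lor I$: from $A$ (or $B$) infer $A\lor B$; $\lor E$: from $A\lor B$, a deduction of $C$ from $[A]$ and a deduction of $C$ from $[B]$, infer $C$ discharging $A$ and $B$; $\bot E$: from $\bot$ infer $B$, with $B$ atomic. Quantifiers: $\forall I$: from a deduction of $A_y^x$ from $[\exists! y]$ infer $\forall xA$, discharging $\exists!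 y$, where $y$ is not free in any undischarged assumption other than $\exists! y$, and $y$ is $x$ or not free in $A$. $\forall E$: from $\forall xA$ and $\exists! t$ infer $A_t^x$. $\exists I$: from $A_t^x$ and $\exists! t$ infer $\exists xA$. $\exists E$: from $\exists xA$ and a deduction of $C$ from $[A_y^x],[\exists! y]$ infer $C$ discharging these, where $y$ is not free in $C$ nor in undischarged assumptions other than $A_y^x,\exists! y$, and $y$ is $x$ or not free in $A$. Identity and strictness: $=I^n$: from $\exists! t$ infer $t=t$. $=E$: from $t_1=t_2$ and $A_{t_1}^x$ infer $A_{t_2}^x$, where $A$ is atomic, $x$ free in $A$, $t_1,t_2$ distinct. $AD$: from an atomic $P t_1\ldots t_n$ ($P$ an $n$-place predicate letter, including identity) infer $\exists! t_i$. $FD$: from $\exists! f t_1\ldots t_n$ infer $\exists! t_i$. $\iota$ rules: $\iota I$: from $F_t^x$, $G_t^x$, $\exists! t$ and a deduction of $z=t$ from $[F_z^x],[\exists! z]$, infer $\iota x[F,G]$ discharging $F_z^x,\exists! z$; here $t$ is free for $x$ in $F,G$, and $z$ is distinct from $x$, not free in $t$, and not free in undischarged assumptions of that subdeduction other than $F_z^x,\exists!z$. $\iota E^1$: from $\iota x[F,G]$ and a deduction of $C$ from $[F_z^x],[G_z^x],[\exists! z]$ infer $C$ discharging these, where $z$ is not free in $C$ nor undischarged assumptions other than these three, and $z$ is $x$ or not free in $F,G$. $\iota E^2$: from $\iota x[F,G]$, $\exists! t_1$, $\exists! t_2$, $F_{t_1}^x$, $F_{t_2}^x$ infer $t_1=t_2$.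 Normal form: The major premise of an elimination rule ($\land E,\rightarrow E,\lor E,\forall E,\exists E,\iota E^1,\iota E^2$) is the premise containing the constant the rule governs; others are minor. ($AD,FD,=I^n,=E$ are not counted as introduction/elimination rules for $\exists!$ or $=$, and $\iota E^2$ is not an introduction rule for $=$.) A maximal formula is a formula occurrence that is the conclusion of an introduction rule ($\land I,\rightarrow I,\lor I,\forall I,\exists I,\iota I$) and the major premise of an elimination rule for its main connective. A segment is a sequence of occurrences of the same formula, each (except the last) a minor premise of $\lor E$, $\exists E$ or $\iota E^1$ whose conclusion is the next one (the first is only a minor premise, the last only a conclusion); it is maximal if its first formula is concluded by an introduction rule for its main connective and its last formula is the major premise of an elimination rule for it. A deduction is in normal form if it contains no maximal formulas and no maximal segments.
   Formalization: The rule ιI is given the additional side condition that z is not free in F (distinct from its bound x), without which the rule is unsound and the claim false; formulas differing only in the names of bound variables are identified, so ''t is free for x'' holds automatically. *)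

(* Defs.v *)
From Stdlib Require List.
From mathcomp Require Import all_boot.
Set Implicit Arguments.
Unset Strict Implicit.
Unset Printing Implicit Defensive.

Record language := Language {
  fletter : Type;               (* function letters *)
  farity : fletter -> nat;
  pletter : Type;               (* predicate letters *)
  parity : pletter -> nat
}.

(* Formulas differing only in the names of bound variables are identified:
   bound variables are de Bruijn indices.  Under k binders the index k + n
   denotes the free variable n.  [{ffun 'I_n -> term L}] is the type of
   n-tuples of terms. *)
Inductive term (L : language) : Type :=
| Var (x : nat)
| Fn (f : fletter L) (ts : {ffun 'I_(farity f) -> term L}).

Arguments Var {L} x.
Arguments Fn {L} f ts.

Inductive form (L : language) : Type :=
| Pred (P : pletter L) (ts : {ffun 'I_(parity P) -> term L})
| Eq (t1 t2 : term L)
| Exists1 (t : term L)          (* E! t, "t exists" *)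
| Bot
| And (A B : form L)
| Or (A B : form L)
| Imp (A B : form L)
| All (A : form L)
| Ex (A : form L)
| Iota (F G : form L).          (* iota x[F, G]: binds index 0 in F and in G *)

Arguments Pred {L} P ts.
Arguments Bot {L}.

Definition atomic (L : language) (A : form L) : Prop :=
  match A with
  | Pred _ _ | Eq _ _ | Exists1 _ | Bot => True
  | _ => False
  end.

Fixpoint tfree (L : language) (y : nat) (t : term L) : Prop :=
  match t with
  | Var x => x = y
  | Fn f ts => exists i, tfree y (ts i)
  end.

(* [free y A]: the variable y occurs free in A.  For the matrix A of a
   quantified formula, [free y.+1 A] thus says that y is free in that formula,
   and [free 0 A] that the quantified variable occurs free in the matrix. *)
Fixpoint free (L : language) (y : nat) (A : form L) : Prop :=
  match A with
  | Pred P ts => exists i, tfree y (ts i)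
  | Eq t1 t2 => tfree y t1 \/ tfree y t2
  | Exists1 t => tfree y t
  | Bot => False
  | And A B | Or A B | Imp A B => free y A \/ free y B
  | All A | Ex A => free y.+1 A
  | Iota F G => free y.+1 F \/ free y.+1 G
  end.

Fixpoint tsubst (L : language) (s : nat -> term L) (t : term L) : term L :=
  match t with
  | Var x => s x
  | Fn f ts => Fn f [ffun i => tsubst s (ts i)]
  end.

Definition up (L : language) (s : nat -> term L) (x : nat) : term L :=
  if x is x'.+1 then tsubst (fun k => Var k.+1) (s x') else Var 0.

Fixpoint subst (L : language) (s : nat -> term L) (A : form L) : form L :=
  match A with
  | Pred P ts => Pred P [ffun i => tsubst s (ts i)]
  | Eq t1 t2 => Eq (tsubst s t1) (tsubst s t2)
  | Exists1 t => Exists1 (tsubst s t)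
  | Bot => Bot
  | And A B => And (subst s A) (subst s B)
  | Or A B => Or (subst s A) (subst s B)
  | Imp A B => Imp (subst s A) (subst s B)
  | All A => All (subst (up s) A)
  | Ex A => Ex (subst (up s) A)
  | Iota F G => Iota (subst (up s) F) (subst (up s) G)
  end.

(* A_t^x, where A is the matrix of a formula binding x. *)
Definition inst (L : language) (A : form L) (t : term L) : form L :=
  subst (fun x => if x is x'.+1 then Var x' else t) A.

(* Trees of rule applications; [correct] below singles out the deductions.
   An assumption carries a label u, and a discharging rule with label u
   discharges the assumptions labelled u (possibly none) of the relevant forms,
   so that any choice of occurrences to be discharged can be expressed.
   Other arguments: the eigenvariable y or z, the formulas and terms by which
   the rule is instantiated, then the deductions of the premises, in the order
   in which the rules list them (the major premise of an elimination first). *)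
Inductive tree (L : language) : Type :=
| Assume (u : nat) (A : form L)
| AndI (D1 D2 : tree L)
| AndE1 (A B : form L) (D : tree L)
| AndE2 (A B : form L) (D : tree L)
| ImpI (u : nat) (A : form L) (D : tree L)
| ImpE (A B : form L) (D D1 : tree L)
| OrI1 (A B : form L) (D : tree L)
| OrI2 (A B : form L) (D : tree L)
| OrE (u : nat) (A B : form L) (D D1 D2 : tree L)
| BotE (B : form L) (D : tree L)
| AllI (u y : nat) (A : form L) (D : tree L)
| AllE (A : form L) (t : term L) (D D1 : tree L)
| ExI (A : form L) (t : term L) (D D1 : tree L)
| ExE (u y : nat) (A : form L) (D D1 : tree L)
| EqI (t : term L) (D : tree L)
| EqE (A : form L) (t1 t2 : term L) (D D1 : tree L)
| ADPred (P : pletter L) (ts : {ffun 'I_(parity P) -> term L})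
    (i : 'I_(parity P)) (D : tree L)
| ADEq1 (t1 t2 : term L) (D : tree L)
| ADEq2 (t1 t2 : term L) (D : tree L)
| FD (f : fletter L) (ts : {ffun 'I_(farity f) -> term L})
    (i : 'I_(farity f)) (D : tree L)
| IotaI (u z : nat) (F G : form L) (t : term L) (D1 D2 D3 D4 : tree L)
| IotaE1 (u z : nat) (F G : form L) (D D1 : tree L)
| IotaE2 (F G : form L) (t1 t2 : term L) (D D1 D2 D3 D4 : tree L).

Fixpoint concl (L : language) (D : tree L) : form L :=
  match D with
  | Assume _ A => A
  | AndI D1 D2 => And (concl D1) (concl D2)
  | AndE1 A _ _ => A
  | AndE2 _ B _ => B
  | ImpI _ A D => Imp A (concl D)
  | ImpE _ B _ _ => B
  | OrI1 A B _ => Or A B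
  | OrI2 A B _ => Or A B
  | OrE _ _ _ _ D1 _ => concl D1
  | BotE B _ => B
  | AllI _ _ A _ => All A
  | AllE A t _ _ => inst A t
  | ExI A _ _ _ => Ex A
  | ExE _ _ _ _ D1 => concl D1
  | EqI t _ => Eq t t
  | EqE A _ t2 _ _ => inst A t2
  | ADPred _ ts i _ => Exists1 (ts i)
  | ADEq1 t1 _ _ => Exists1 t1
  | ADEq2 _ t2 _ => Exists1 t2
  | FD _ ts i _ => Exists1 (ts i)
  | IotaI _ _ F G _ _ _ _ _ => Iota F G
  | IotaE1 _ _ _ _ _ D1 => concl D1
  | IotaE2 _ _ t1 t2 _ _ _ _ _ => Eq t1 t2
  end.

(* Removes from a set of labelled assumptions those labelled u whose formula is
   in Ds. *)
Definition discharge (L : language) (u : nat) (Ds : list (form L))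
    (S : nat -> form L -> Prop) : nat -> form L -> Prop :=
  fun v B => S v B /\ ~ (v = u /\ List.In B Ds).

(* [undischarged D v B]: some assumption B labelled v is undischarged in D. *)
Fixpoint undischarged (L : language) (D : tree L) : nat -> form L -> Prop :=
  match D with
  | Assume u A => fun v B => v = u /\ B = A
  | AndI D1 D2 => fun v B => undischarged D1 v B \/ undischarged D2 v B
  | AndE1 _ _ D | AndE2 _ _ D | OrI1 _ _ D | OrI2 _ _ D | BotE _ D | EqI _ D
  | ADPred _ _ _ D | ADEq1 _ _ D | ADEq2 _ _ D | FD _ _ _ D => undischarged D
  | ImpI u A D => discharge u [:: A] (undischarged D)
  | ImpE _ _ D D1 | AllE _ _ D D1 | ExI _ _ D D1 | EqE _ _ _ D D1 =>
      fun v B => undischarged D v B \/ undischarged D1 v B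
  | OrE u A B D D1 D2 => fun v C =>
      [\/ undischarged D v C, discharge u [:: A] (undischarged D1) v C
        | discharge u [:: B] (undischarged D2) v C]
  | AllI u y A D => discharge u [:: Exists1 (Var y)] (undischarged D)
  | ExE u y A D D1 => fun v B => undischarged D v B \/
      discharge u [:: inst A (Var y); Exists1 (Var y)] (undischarged D1) v B
  | IotaI u z F G t D1 D2 D3 D4 => fun v B =>
      [\/ undischarged D1 v B, undischarged D2 v B, undischarged D3 v B
        | discharge u [:: inst F (Var z); Exists1 (Var z)]
            (undischarged D4) v B]
  | IotaE1 u z F G D D1 => fun v B => undischarged D v B \/
      discharge u [:: inst F (Var z); inst G (Var z); Exists1 (Var z)]
        (undischarged D1) v B
  | IotaE2 _ _ _ _ D D1 D2 D3 D4 => fun v B =>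
      undischarged D v B \/
      [\/ undischarged D1 v B, undischarged D2 v B, undischarged D3 v B
        | undischarged D4 v B]
  end.

Definition assumption (L : language) (D : tree L) (B : form L) : Prop :=
  exists v, undischarged D v B.

(* y is not free in any undischarged assumption of D other than those labelled
   u whose formula is in Ds. *)
Definition eigen (L : language) (u y : nat) (Ds : list (form L)) (D : tree L) :
    Prop :=
  forall v B, discharge u Ds (undischarged D) v B -> ~ free y B.

Fixpoint correct (L : language) (D : tree L) : Prop :=
  match D with
  | Assume _ _ => True
  | AndI D1 D2 => correct D1 /\ correct D2
  | AndE1 A B D | AndE2 A B D => concl D = And A B /\ correct D
  | ImpI _ _ D => correct D
  | ImpE A B D D1 =>
      [/\ concl D = Imp A B, concl D1 = A, correct D & correct D1]
  | OrI1 A B D => concl D = A /\ correct D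
  | OrI2 A B D => concl D = B /\ correct D
  | OrE _ A B D D1 D2 =>
      [/\ concl D = Or A B, concl D2 = concl D1, correct D, correct D1
        & correct D2]
  | BotE B D => [/\ atomic B, concl D = Bot & correct D]
  | AllI u y A D =>
      [/\ concl D = inst A (Var y), eigen u y [:: Exists1 (Var y)] D,
          ~ free y.+1 A & correct D]
  | AllE A t D D1 =>
      [/\ concl D = All A, concl D1 = Exists1 t, correct D & correct D1]
  | ExI A t D D1 =>
      [/\ concl D = inst A t, concl D1 = Exists1 t, correct D & correct D1]
  | ExE u y A D D1 =>
      [/\ concl D = Ex A, correct D & correct D1] /\
      [/\ eigen u y [:: inst A (Var y); Exists1 (Var y)] D1,
          ~ free y (concl D1) & ~ free y.+1 A]
  | EqI t D => concl D = Exists1 t /\ correct D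
  | EqE A t1 t2 D D1 =>
      [/\ atomic A, free 0 A & t1 <> t2] /\
      [/\ concl D = Eq t1 t2, concl D1 = inst A t1, correct D & correct D1]
  | ADPred P ts _ D => concl D = Pred P ts /\ correct D
  | ADEq1 t1 t2 D | ADEq2 t1 t2 D => concl D = Eq t1 t2 /\ correct D
  | FD f ts _ D => concl D = Exists1 (Fn f ts) /\ correct D
  | IotaI u z F G t D1 D2 D3 D4 =>
      [/\ concl D1 = inst F t, concl D2 = inst G t, concl D3 = Exists1 t
        & concl D4 = Eq (Var z) t] /\
      [/\ correct D1, correct D2, correct D3 & correct D4] /\
      (* As for the other eigenvariables, z is not free in F: otherwise
         inst F (Var z) is not a generic instance of F. *)
      [/\ eigen u z [:: inst F (Var z); Exists1 (Var z)] D4,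
          ~ tfree z t & ~ free z.+1 F]
  | IotaE1 u z F G D D1 =>
      [/\ concl D = Iota F G, correct D & correct D1] /\
      [/\ eigen u z [:: inst F (Var z); inst G (Var z); Exists1 (Var z)] D1,
          ~ free z (concl D1), ~ free z.+1 F & ~ free z.+1 G]
  | IotaE2 F G t1 t2 D D1 D2 D3 D4 =>
      [/\ concl D = Iota F G, concl D1 = Exists1 t1, concl D2 = Exists1 t2,
          concl D3 = inst F t1 & concl D4 = inst F t2] /\
      [/\ correct D, correct D1, correct D2, correct D3 & correct D4]
  end.

(* D is a deduction of A whose set of undischarged assumptions is Gamma. *)
Definition deduction (L : language) (Gamma : form L -> Prop) (A : form L)
    (D : tree L) : Prop :=
  [/\ correct D, concl D = A & forall B, assumption D B <-> Gamma B].

Definition premises (L : language) (D : tree L) : list (tree L) :=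
  match D with
  | Assume _ _ => [::]
  | AndE1 _ _ D | AndE2 _ _ D | ImpI _ _ D | OrI1 _ _ D | OrI2 _ _ D
  | BotE _ D | AllI _ _ _ D | EqI _ D | ADPred _ _ _ D | ADEq1 _ _ D
  | ADEq2 _ _ D | FD _ _ _ D => [:: D]
  | AndI D D1 | ImpE _ _ D D1 | AllE _ _ D D1 | ExI _ _ D D1 | ExE _ _ _ D D1
  | EqE _ _ _ D D1 | IotaE1 _ _ _ _ D D1 => [:: D; D1]
  | OrE _ _ _ D D1 D2 => [:: D; D1; D2]
  | IotaI _ _ _ _ _ D1 D2 D3 D4 => [:: D1; D2; D3; D4]
  | IotaE2 _ _ _ _ D D1 D2 D3 D4 => [:: D; D1; D2; D3; D4]
  end.

(* The formula occurrences of a deduction are represented by the subdeductions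
   of which they are the conclusions. *)
Inductive occurs (L : language) (E : tree L) : tree L -> Prop :=
| occurs_here : occurs E E
| occurs_above D D' : List.In D' (premises D) -> occurs E D' -> occurs E D.

Definition by_introduction (L : language) (D : tree L) : Prop :=
  match D with
  | AndI _ _ | ImpI _ _ _ | OrI1 _ _ _ | OrI2 _ _ _ | AllI _ _ _ _
  | ExI _ _ _ _ | IotaI _ _ _ _ _ _ _ _ _ => True
  | _ => False
  end.

(* The major premise of the last rule of D, if that is an elimination rule. *)
Definition major_premise (L : language) (D : tree L) : option (tree L) :=
  match D with
  | AndE1 _ _ D | AndE2 _ _ D | ImpE _ _ D _ | OrE _ _ _ D _ _ | AllE _ _ D _
  | ExE _ _ _ D _ | IotaE1 _ _ _ _ D _ | IotaE2 _ _ _ _ D _ _ _ _ => Some D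
  | _ => None
  end.

(* The minor premises of the last rule of D, if that is one of the rules
   OrE, ExE, IotaE1. *)
Definition del_minors (L : language) (D : tree L) : list (tree L) :=
  match D with
  | OrE _ _ _ _ D1 D2 => [:: D1; D2]
  | ExE _ _ _ _ D1 | IotaE1 _ _ _ _ _ D1 => [:: D1]
  | _ => [::]
  end.

(* In a correct tree a rule introduces, or eliminates, the main connective of
   its conclusion, respectively major premise, so by_introduction and
   major_premise need not mention the connective. *)
Definition maximal_formula (L : language) (D E : tree L) : Prop :=
  by_introduction E /\
  exists R, occurs R D /\ major_premise R = Some E.

(* [segment E E']: a sequence of at least two occurrences from E to E', each
   but the last a minor premise of OrE, ExE or IotaE1 whose conclusion is the
   next one.  That E is not itself the conclusion, nor E' a minor premise, of
   such a rule is automatic in the maximal segments below. *)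
Inductive segment (L : language) (E : tree L) : tree L -> Prop :=
| segment_two E' : List.In E (del_minors E') -> segment E E'
| segment_next E' E'' :
    segment E E' -> List.In E' (del_minors E'') -> segment E E''.

Definition maximal_segment (L : language) (D E E' : tree L) : Prop :=
  [/\ segment E E', by_introduction E
    & exists R, occurs R D /\ major_premise R = Some E'].

Definition normal (L : language) (D : tree L) : Prop :=
  (forall E, ~ maximal_formula D E) /\
  (forall E E', ~ maximal_segment D E E').

(* Main.v *)
Require Import Defs.
From Stdlib Require List Classical FunctionalExtensionality.
From mathcomp Require Import all_boot.
Set Implicit Arguments.
Unset Strict Implicit.
Unset Printing Implicit Defensive.

(** Normalization by evaluation.  Formulas are interpreted in a Beth model whose
    worlds are finite contexts: an atomic formula is forced at a context if it
    has a normal deduction from it, and disjunctions, existential formulas and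
    [Iota F G] are forced if the corresponding disjunct or witness is available
    at every leaf of a tree of case distinctions on neutral deductions.  Every
    deduction is sound for this model, every context forces its own members,
    and a formula forced at a context has a normal deduction from it. *)

Import FunctionalExtensionality.

(** The arguments of [Fn] are nested inside [{ffun _}], so their induction hypotheses are supplied
    by hand. *)
Lemma term_nested_ind (L : language) (P : term L -> Prop) :
  (forall x, P (Var x)) ->
  (forall f (ts : {ffun _ -> _}), (forall i, P (ts i)) -> P (@Fn L f ts)) ->
  forall t, P t.
Proof.
move=> PV PF; fix IH 1; case=> [x | f ts]; first exact: PV.
by apply: PF => i; apply: IH.
Qed.

(** * Substitution and free variables *)

Definition scons (L : language) (t : term L) (s : nat -> term L) (x : nat) :
    term L :=
  if x is x'.+1 then s x' else t.

Definition update (L : language) (s : nat -> term L) (y : nat) (t : term L)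
    (x : nat) : term L :=
  if x == y then t else s x.

Section Substitution.
Variable L : language.
Implicit Types (t : term L) (A : form L) (s r : nat -> term L).

Lemma tsubst_free s r t :
  (forall x, tfree x t -> s x = r x) -> tsubst s t = tsubst r t.
Proof.
elim/term_nested_ind: t => [x | f ts IH] /= E; first exact: E.
congr Fn; apply/ffunP => i; rewrite !ffunE; apply: IH => x xi.
by apply: E; exists i.
Qed.

Lemma tsubst_comp s r t :
  tsubst s (tsubst r t) = tsubst (fun x => tsubst s (r x)) t.
Proof.
elim/term_nested_ind: t => [x | f ts IH] //=.
by congr Fn; apply/ffunP => i; rewrite !ffunE.
Qed.

Lemma tsubst_id t : tsubst Var t = t.
Proof.
elim/term_nested_ind: t => [x | f ts IH] //=.
by congr Fn; apply/ffunP => i; rewrite ffunE.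
Qed.

Lemma up_comp s r :
  (fun x => tsubst (up s) (up r x)) = up (fun x => tsubst s (r x)).
Proof.
by apply: functional_extensionality => -[|x] //=; rewrite !tsubst_comp.
Qed.

Lemma up_id : up (@Var L) = Var.
Proof. by apply: functional_extensionality => -[|x]. Qed.

Lemma subst_comp s r A :
  subst s (subst r A) = subst (fun x => tsubst s (r x)) A.
Proof.
elim: A s r => [P ts|t1 t2|t||A IA B IB|A IA B IB|A IA B IB|A IA|A IA|F IF G IG]
  s r /=; rewrite ?tsubst_comp ?IA ?IB ?IF ?IG ?up_comp //.
by congr Pred; apply/ffunP => i; rewrite !ffunE tsubst_comp.
Qed.

Lemma subst_id A : subst Var A = A.
Proof.
elim: A => [P ts|t1 t2|t||A IA B IB|A IA B IB|A IA B IB|A IA|A IA|F IF G IG]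
  /=; rewrite ?tsubst_id ?up_id ?IA ?IB ?IF ?IG //.
by congr Pred; apply/ffunP => i; rewrite !ffunE tsubst_id.
Qed.

Lemma inst_up s A t : inst (subst (up s) A) t = subst (scons t s) A.
Proof.
rewrite /inst subst_comp; congr subst.
apply: functional_extensionality => -[|x] //=.
by rewrite tsubst_comp [LHS]tsubst_id.
Qed.

Lemma tsubst_scons s t :
  (fun x => tsubst s (if x is x'.+1 then Var x' else t)) =
  scons (tsubst s t) s.
Proof. by apply: functional_extensionality => -[]. Qed.

Lemma subst_inst s A t : subst s (inst A t) = inst (subst (up s) A) (tsubst s t).
Proof. by rewrite inst_up /inst subst_comp tsubst_scons. Qed.

Lemma tsubst_scons_up s r t :
  (fun x => tsubst (scons t s) (up r x)) =
  scons t (fun x => tsubst s (r x)).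
Proof.
apply: functional_extensionality => -[|x] //=.
by rewrite tsubst_comp; apply: tsubst_free.
Qed.

Lemma tfree_up s t : tfree 0 t -> tfree 0 (tsubst (up s) t).
Proof.
elim/term_nested_ind: t => [x -> | f ts IH [i ti]] //=.
by exists i; rewrite ffunE; apply: IH.
Qed.

Lemma atomic_subst s A : atomic A -> atomic (subst s A).
Proof. by case: A. Qed.

(** Meant for [EqE]: soundness applies that rule to formulas already substituted by an environment,
    and its side condition has to survive this. *)
Lemma atomic_free_up s A : atomic A -> free 0 A -> free 0 (subst (up s) A).
Proof.
case: A => //= [P ts|t1 t2|t] _.
- by case=> i ti; exists i; rewrite ffunE; apply: tfree_up.
- by case=> ti; [left | right]; apply: tfree_up.
- exact: tfree_up.
Qed.

Lemma tfree_bound t : exists n, forall y, n <= y -> ~ tfree y t.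
Proof.
elim/term_nested_ind: t => [x | f ts IH].
  by exists x.+1 => y /= xy ey; rewrite ey ltnn in xy.
have [n Hn] := fin_all_exists IH.
exists (\max_i n i) => y ny [i]; apply: Hn.
exact: leq_trans (leq_bigmax i) ny.
Qed.

Lemma free_bound A : exists n, forall y, n <= y -> ~ free y A.
Proof.
have bin (P Q : nat -> Prop) : (exists n, forall y, n <= y -> ~ P y) ->
    (exists n, forall y, n <= y -> ~ Q y) ->
    exists n, forall y, n <= y -> ~ (P y \/ Q y).
  move=> [n Hn] [m Hm]; exists (maxn n m) => y.
  by rewrite geq_max => /andP[/Hn ? /Hm ?] [].
have bnd (P : nat -> Prop) : (exists n, forall y, n <= y -> ~ P y) ->
    exists n, forall y, n <= y -> ~ P y.+1.
  by move=> [n Hn]; exists n => y ny; apply: Hn; apply: leqW.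
elim: A => [P ts|t1 t2|t||A IA B IB|A IA B IB|A IA B IB|A IA|A IA|F IF G IG] /=;
  try by [exact: (bin _ _ IA IB) | exact: (bnd _ IA)].
- have [n Hn] := fin_all_exists (fun i => tfree_bound (ts i)).
  exists (\max_i n i) => y ny [i]; apply: Hn.
  exact: leq_trans (leq_bigmax i) ny.
- exact: (bin _ _ (tfree_bound t1) (tfree_bound t2)).
- exact: tfree_bound.
- by exists 0 => y _ [].
- exact: (bin _ _ (bnd _ IF) (bnd _ IG)).
Qed.

(** Only finitely many variables are free in a finite list. The lower bound [n] is the one that a
    branching of [cover] places on its eigenvariables. *)
Lemma fresh_above (n : nat) (l : list (form L)) :
  exists2 y, n <= y & forall B, List.In B l -> ~ free y B.
Proof.
suff [m Hm] : exists m, forall y, m <= y -> forall B, List.In B l -> ~ free y B.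
  exists (maxn n m); first exact: leq_maxl.
  by apply: Hm; apply: leq_maxr.
elim: l => [|A l [m Hm]]; first by exists 0.
have [k Hk] := free_bound A.
exists (maxn k m) => y; rewrite geq_max => /andP[ky my] B [<-|]; first exact: Hk.
exact: Hm.
Qed.

End Substitution.

(** * Normal and neutral deductions from a finite context *)

Section Normal.
Variable L : language.
Implicit Types (t : term L) (A B C F G : form L) (D E : tree L).
Implicit Types (Gam Del : list (form L)).

(** Rules whose conclusion may serve as a major premise. The others are introductions, the case
    distinctions [OrE], [ExE] and [IotaE1], and rules with an atomic conclusion, which no
    elimination rule takes as its major premise. *)
Definition neutral D : Prop :=
  match D with
  | Assume _ _ | AndE1 _ _ _ | AndE2 _ _ _ | ImpE _ _ _ _ | AllE _ _ _ _ => True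
  | _ => False
  end.

Definition neutral_majors D : Prop :=
  forall R E, occurs R D -> major_premise R = Some E -> neutral E.

(** A maximal formula is concluded by an introduction, and the end of a segment by [OrE], [ExE] or
    [IotaE1]; neither is neutral. *)
Lemma neutral_majors_normal D : neutral_majors D -> normal D.
Proof.
move=> nD; split.
  by move=> E [iE [R [oR mR]]]; have := nD _ _ oR mR; case: E iE mR.
move=> E E' [sE _ [R [oR mR]]]; have nE' := nD _ _ oR mR.
have [E0 inE0] : exists E0, List.In E0 (del_minors E') by case: sE => *; eauto.
by case: E' inE0 nE' {sE mR}.
Qed.

Lemma neutral_majors_intro D :
  (forall E, major_premise D = Some E -> neutral E) ->
  (forall D', List.In D' (premises D) -> neutral_majors D') ->
  neutral_majors D.
Proof.
move=> mD pD R E oR; case: D / oR mD pD => [mD _|D D' inD' oR _ pD].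
  exact: mD.
exact: pD inD' _ _ oR.
Qed.

(* Every assumption carries the label 0, so that a rule discharges all
   assumptions of the relevant forms. *)
Definition derives Gam A D : Prop :=
  [/\ correct D, concl D = A, neutral_majors D
    & forall v B, undischarged D v B -> v = 0 /\ List.In B Gam].

Definition nf Gam A : Prop := exists D, derives Gam A D.
Definition ne Gam A : Prop := exists2 D, derives Gam A D & neutral D.

Lemma ne_nf Gam A : ne Gam A -> nf Gam A.
Proof. by case=> D HD _; exists D. Qed.

Lemma derives_incl Gam Del A D :
  List.incl Gam Del -> derives Gam A D -> derives Del A D.
Proof. by move=> sub [cD eD nD uD]; split=> // v B /uD[-> /sub]. Qed.

Lemma nf_incl Gam Del A : List.incl Gam Del -> nf Gam A -> nf Del A.
Proof. by move=> sub [D HD]; exists D; apply: derives_incl HD. Qed.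

Lemma ne_incl Gam Del A : List.incl Gam Del -> ne Gam A -> ne Del A.
Proof. by move=> sub [D HD nD]; exists D => //; apply: derives_incl HD. Qed.

Lemma discharge_context Gam Ds D :
  (forall v B, undischarged D v B -> v = 0 /\ List.In B (Ds ++ Gam)) ->
  forall v B, discharge 0 Ds (undischarged D) v B -> v = 0 /\ List.In B Gam.
Proof.
move=> uD v B [/uD[-> inB] nB]; split=> //.
by have [inD|] := List.in_app_or _ _ _ inB => //; case: nB.
Qed.

Lemma eigen_context Gam Ds y D :
  (forall v B, undischarged D v B -> v = 0 /\ List.In B (Ds ++ Gam)) ->
  (forall B, List.In B Gam -> ~ free y B) -> eigen 0 y Ds D.
Proof. by move=> /discharge_context uD fr v B /uD[_ /fr]. Qed.

Ltac majors := apply: neutral_majors_intro => /=;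
  [ by move=> ? // [<-] | by move=> ?; intuition (subst; assumption) ].
Ltac ctx_union := by move=> ? ? /= [] ?; eauto.

(** * Closure of neutral and normal derivability under the rules *)

Lemma ne_assume Gam A : List.In A Gam -> ne Gam A.
Proof.
move=> inA; exists (Assume 0 A) => //; split=> //; first majors.
by move=> v B /= [-> ->].
Qed.

Lemma ne_andE1 Gam A B : ne Gam (And A B) -> ne Gam A.
Proof. by case=> D [? ? ? ?] ?; exists (AndE1 A B D) => //; split=> //; majors. Qed.

Lemma ne_andE2 Gam A B : ne Gam (And A B) -> ne Gam B.
Proof. by case=> D [? ? ? ?] ?; exists (AndE2 A B D) => //; split=> //; majors. Qed.

Lemma ne_impE Gam A B : ne Gam (Imp A B) -> nf Gam A -> ne Gam B.
Proof.
case=> D [? ? ? ?] ? [D1 [? ? ? ?]]; exists (ImpE A B D D1) => //.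
split=> //; [majors | ctx_union].
Qed.

Lemma ne_allE Gam A t : ne Gam (All A) -> nf Gam (Exists1 t) -> ne Gam (inst A t).
Proof.
case=> D [? ? ? ?] ? [D1 [? ? ? ?]]; exists (AllE A t D D1) => //.
split=> //; [majors | ctx_union].
Qed.

Lemma nf_andI Gam A B : nf Gam A -> nf Gam B -> nf Gam (And A B).
Proof.
case=> D [? <- ? ?] [D1 [? <- ? ?]]; exists (AndI D D1).
split=> //; [majors | ctx_union].
Qed.

Lemma nf_impI Gam A B : nf (A :: Gam) B -> nf Gam (Imp A B).
Proof.
case=> D [? <- ? uD]; exists (ImpI 0 A D).
split=> //; [majors | exact: discharge_context].
Qed.

Lemma nf_orI1 Gam A B : nf Gam A -> nf Gam (Or A B).
Proof. by case=> D [? ? ? ?]; exists (OrI1 A B D); split=> //; majors. Qed.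

Lemma nf_orI2 Gam A B : nf Gam B -> nf Gam (Or A B).
Proof. by case=> D [? ? ? ?]; exists (OrI2 A B D); split=> //; majors. Qed.

Lemma nf_orE Gam A B C :
  ne Gam (Or A B) -> nf (A :: Gam) C -> nf (B :: Gam) C -> nf Gam C.
Proof.
case=> D [? ? ? ?] ? [D1 [? ? ? u1]] [D2 [? ? ? u2]].
exists (OrE 0 A B D D1 D2); split=> //.
- by split=> //; congruence.
- majors.
- have {}u1 := @discharge_context Gam [:: A] _ u1.
  have {}u2 := @discharge_context Gam [:: B] _ u2.
  by move=> v E /= [] //; eauto.
Qed.

Lemma nf_botE Gam B : atomic B -> nf Gam Bot -> nf Gam B.
Proof. by move=> ? [D [? ? ? ?]]; exists (BotE B D); split=> //; majors. Qed.

(** Putting [All A] on the list covers the side condition on [A], because [free y (All A)] unfolds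
    to [free y.+1 A]. *)
Lemma nf_allI Gam y A :
  (forall B, List.In B (All A :: Gam) -> ~ free y B) ->
  nf (Exists1 (Var y) :: Gam) (inst A (Var y)) -> nf Gam (All A).
Proof.
move=> fr [D [? ? ? uD]]; exists (AllI 0 y A D); split=> //.
- split=> //; last by apply: (fr (All A)); left.
  by apply: (@eigen_context Gam) => // B inB; apply: fr; right.
- majors.
- exact: discharge_context.
Qed.

Lemma nf_exI Gam A t : nf Gam (inst A t) -> nf Gam (Exists1 t) -> nf Gam (Ex A).
Proof.
case=> D [? ? ? ?] [D1 [? ? ? ?]]; exists (ExI A t D D1).
split=> //; [majors | ctx_union].
Qed.

Lemma nf_exE Gam y A C :
  (forall B, List.In B [:: Ex A, C & Gam] -> ~ free y B) ->
  ne Gam (Ex A) -> nf [:: inst A (Var y), Exists1 (Var y) & Gam] C -> nf Gam C.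
Proof.
move=> fr [D [? ? ? ?] ?] [D1 [? e1 ? u1]].
exists (ExE 0 y A D D1); split=> //.
- split=> //; split.
  + by apply: (@eigen_context Gam) => // B inB; apply: fr; right; right.
  + by rewrite e1; apply: fr; right; left.
  + by apply: (fr (Ex A)); left.
- majors.
- have {}u1 := @discharge_context Gam [:: _; _] _ u1.
  by move=> v E /= [] //; eauto.
Qed.

Lemma nf_eqI Gam t : nf Gam (Exists1 t) -> nf Gam (Eq t t).
Proof. by case=> D [? ? ? ?]; exists (EqI t D); split=> //; majors. Qed.

Lemma nf_eqE Gam A t1 t2 : atomic A -> free 0 A ->
  nf Gam (Eq t1 t2) -> nf Gam (inst A t1) -> nf Gam (inst A t2).
Proof.
move=> atA frA [D [? ? ? ?]] [D1 [? ? ? ?]].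
(* [EqE] wants distinct terms; if they coincide, the other premise already is the conclusion. The
   case distinction is classical because function letters come from an arbitrary type. *)
have [<-|neq] := Classical_Prop.classic (t1 = t2); first by exists D1.
exists (EqE A t1 t2 D D1); split=> //; [majors | ctx_union].
Qed.

Lemma nf_adpred Gam P ts i : nf Gam (@Pred L P ts) -> nf Gam (Exists1 (ts i)).
Proof. by case=> D [? ? ? ?]; exists (ADPred ts i D); split=> //; majors. Qed.

Lemma nf_adeq1 Gam t1 t2 : nf Gam (Eq t1 t2) -> nf Gam (Exists1 t1).
Proof. by case=> D [? ? ? ?]; exists (ADEq1 t1 t2 D); split=> //; majors. Qed.

Lemma nf_adeq2 Gam t1 t2 : nf Gam (Eq t1 t2) -> nf Gam (Exists1 t2).
Proof. by case=> D [? ? ? ?]; exists (ADEq2 t1 t2 D); split=> //; majors. Qed.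

Lemma nf_fd Gam f ts i : nf Gam (Exists1 (@Fn L f ts)) -> nf Gam (Exists1 (ts i)).
Proof. by case=> D [? ? ? ?]; exists (FD ts i D); split=> //; majors. Qed.

Lemma nf_iotaI Gam z F G t :
  (forall B, List.In B [:: Iota F G, Exists1 t & Gam] -> ~ free z B) ->
  nf Gam (inst F t) -> nf Gam (inst G t) -> nf Gam (Exists1 t) ->
  nf [:: inst F (Var z), Exists1 (Var z) & Gam] (Eq (Var z) t) ->
  nf Gam (Iota F G).
Proof.
move=> fr [D1 [? ? ? ?]] [D2 [? ? ? ?]] [D3 [? ? ? ?]] [D4 [? ? ? u4]].
exists (IotaI 0 z F G t D1 D2 D3 D4); split=> //.
- do 2![split=> //]; split.
  + by apply: (@eigen_context Gam) => // B inB; apply: fr; right; right.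
  + by apply: (fr (Exists1 t)); right; left.
  + by move=> zF; apply: (fr (Iota F G)); left.
- majors.
- have {}u4 := @discharge_context Gam [:: _; _] _ u4.
  by move=> v E /= [] //; eauto.
Qed.

Lemma nf_iotaE1 Gam z F G C :
  (forall B, List.In B [:: Iota F G, C & Gam] -> ~ free z B) ->
  ne Gam (Iota F G) ->
  nf [:: inst F (Var z), inst G (Var z), Exists1 (Var z) & Gam] C -> nf Gam C.
Proof.
move=> fr [D [? ? ? ?] ?] [D1 [? e1 ? u1]].
exists (IotaE1 0 z F G D D1); split=> //.
- split=> //; split.
  + by apply: (@eigen_context Gam) => // B inB; apply: fr; right; right.
  + by rewrite e1; apply: fr; right; left.
  + by move=> zF; apply: (fr (Iota F G)); left.
  + by move=> zG; apply: (fr (Iota F G)); [left | right].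
- majors.
- have {}u1 := @discharge_context Gam [:: _; _; _] _ u1.
  by move=> v E /= [] //; eauto.
Qed.

Lemma nf_iotaE2 Gam F G t1 t2 :
  ne Gam (Iota F G) -> nf Gam (Exists1 t1) -> nf Gam (Exists1 t2) ->
  nf Gam (inst F t1) -> nf Gam (inst F t2) -> nf Gam (Eq t1 t2).
Proof.
move=> [D [? ? ? ?] ?] [D1 [? ? ? ?]] [D2 [? ? ? ?]] [D3 [? ? ? ?]] [D4 [? ? ? ?]].
exists (IotaE2 F G t1 t2 D D1 D2 D3 D4); split=> //; [majors|].
by move=> v E /= [|[]]; eauto.
Qed.

Lemma tsubst_shift t r : tsubst (scons r Var) (tsubst (fun k => Var k.+1) t) = t.
Proof. by rewrite tsubst_comp [LHS]tsubst_id. Qed.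

(** Symmetry comes from replacement in [t2 = t2], then transitivity from a second replacement. This
    serves [IotaE2] in the model, where two terms are each identical with one witness. *)
Lemma nf_eq_common Gam t1 t2 t :
  nf Gam (Eq t1 t) -> nf Gam (Eq t2 t) -> nf Gam (Eq t1 t2).
Proof.
(* Index 0 marks the place at which [EqE] replaces; [shift] keeps it out of the other side of the
   identity. *)
move=> n1 n2; pose shift := tsubst (fun k => @Var L k.+1).
have sym : nf Gam (Eq t t2).
  have /= := @nf_eqE Gam (Eq (Var 0) (shift t2)) t2 t I (or_introl erefl) n2.
  by rewrite /inst /= !tsubst_shift; apply; apply: nf_eqI; apply: nf_adeq1 n2.
have /= := @nf_eqE Gam (Eq (shift t1) (Var 0)) t t2 I (or_intror erefl) sym.
by rewrite /inst /= !tsubst_shift; apply.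
Qed.

End Normal.

(** * The Beth model of normal deductions *)

Section Model.
Variable L : language.
Implicit Types (t : term L) (A B C F G : form L) (D : tree L).
Implicit Types (Gam Del : list (form L)) (s r : nat -> term L).
Implicit Types (P Q : list (form L) -> Prop).
Implicit Types (phi psi : term L -> list (form L) -> Prop).

(* The eigenvariable ranges over all large enough variables so that it can be
   chosen not free in whatever formula is to be deduced at the leaves. *)
Inductive cover P Gam : Prop :=
| cover_leaf of P Gam
| cover_or A B of ne Gam (Or A B) & cover P (A :: Gam) & cover P (B :: Gam)
| cover_ex A n of ne Gam (Ex A) &
    (forall y, n <= y -> cover P [:: inst A (Var y), Exists1 (Var y) & Gam])
| cover_iota F G n of ne Gam (Iota F G) &
    (forall y, n <= y ->
       cover P [:: inst F (Var y), inst G (Var y), Exists1 (Var y) & Gam]).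

Definition stable P : Prop :=
  forall Gam Del, List.incl Gam Del -> P Gam -> P Del.

(** The sheaf condition of Beth semantics. *)
Definition pasting P : Prop := forall Gam, cover P Gam -> P Gam.

Lemma incl_cons A Gam Del : List.incl Gam Del -> List.incl (A :: Gam) (A :: Del).
Proof. by move=> sub B [|/sub]; [left | right]. Qed.

Lemma cover_incl P : stable P -> stable (cover P).
Proof.
move=> mP Gam Del sub H; elim: H Del sub
  => {Gam} [Gam pG|Gam A B neG _ IA _ IB|Gam A n neG _ IH|Gam F G n neG _ IH]
  Del sub.
- by apply: cover_leaf; apply: mP pG.
- apply: (cover_or (ne_incl sub neG)); [apply: IA | apply: IB];
    exact: incl_cons.
- apply: (@cover_ex _ _ _ n (ne_incl sub neG)) => y ny.
  by apply: (IH y) => //; do 2!apply: incl_cons.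
- apply: (@cover_iota _ _ _ _ n (ne_incl sub neG)) => y ny.
  by apply: (IH y) => //; do 3!apply: incl_cons.
Qed.

(** Covers are grafted onto the leaves of a cover, as in the bind of a monad. Contexts only grow
    towards the leaves, so the hypothesis concerns extensions of [Gam]. *)
Lemma cover_bind P Q Gam :
  (forall Del, List.incl Gam Del -> P Del -> cover Q Del) ->
  cover P Gam -> cover Q Gam.
Proof.
move=> PQ H; elim: H PQ
  => {Gam} [Gam pG|Gam A B neG _ IA _ IB|Gam A n neG _ IH|Gam F G n neG _ IH] PQ.
- by apply: PQ pG.
- apply: (cover_or neG); [apply: IA | apply: IB] => Del sub;
    by apply: PQ => E inE; apply: sub; right.
- apply: (@cover_ex _ _ _ n neG) => y ny; apply: (IH y) => // Del sub.
  by apply: PQ => E inE; apply: sub; do 2!right.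
- apply: (@cover_iota _ _ _ _ n neG) => y ny; apply: (IH y) => // Del sub.
  by apply: PQ => E inE; apply: sub; do 3!right.
Qed.

Lemma cover_map P Q Gam :
  (forall Del, List.incl Gam Del -> P Del -> Q Del) -> cover P Gam -> cover Q Gam.
Proof. by move=> PQ; apply: cover_bind => Del sub pD; apply/cover_leaf/PQ. Qed.

Lemma cover_pasting P : pasting (cover P).
Proof. by move=> Gam; apply: cover_bind. Qed.

Lemma nf_stable A : stable (fun Gam => nf Gam A).
Proof. by move=> Gam Del; apply: nf_incl. Qed.

(** The branchings of the cover become applications of [OrE], [ExE] and [IotaE1] with neutral major
    premises. Their eigenvariables are chosen only now that [C] is known. *)
Lemma nf_pasting C : pasting (fun Gam => nf Gam C).
Proof.
move=> Gam; elim=> {Gam}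
  [//|Gam A B neG _ IA _ IB|Gam A n neG _ IH|Gam F G n neG _ IH].
- exact: nf_orE neG IA IB.
- have [y ny fr] := fresh_above n [:: Ex A, C & Gam].
  exact: nf_exE fr neG (IH _ ny).
- have [y ny fr] := fresh_above n [:: Iota F G, C & Gam].
  exact: nf_iotaE1 fr neG (IH _ ny).
Qed.

(** * The forcing relation *)

Definition force_or P Q : list (form L) -> Prop :=
  cover (fun Gam => P Gam \/ Q Gam).

Definition force_imp P Q Gam : Prop :=
  forall Del, List.incl Gam Del -> P Del -> Q Del.

(** The domain at a context consists of the terms whose existence has a normal deduction from it; it
    grows with the context. *)
Definition force_all phi Gam : Prop :=
  forall Del t, List.incl Gam Del -> nf Del (Exists1 t) -> phi t Del.

Definition force_ex phi : list (form L) -> Prop :=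
  cover (fun Gam => exists2 t, nf Gam (Exists1 t) & phi t Gam).

(** Mirrors the premises of [IotaI]. The uniqueness part ranges over extensions, like an
    implication, so that it persists. *)
Definition force_iota phi psi : list (form L) -> Prop :=
  cover (fun Gam => exists t,
    [/\ nf Gam (Exists1 t), phi t Gam, psi t Gam
      & forall Del t', List.incl Gam Del -> nf Del (Exists1 t') -> phi t' Del ->
          nf Del (Eq t' t)]).

Fixpoint forces A s : list (form L) -> Prop :=
  match A with
  | And A B => fun Gam => forces A s Gam /\ forces B s Gam
  | Or A B => force_or (forces A s) (forces B s)
  | Imp A B => force_imp (forces A s) (forces B s)
  | All A => force_all (fun t => forces A (scons t s))
  | Ex A => force_ex (fun t => forces A (scons t s))
  | Iota F G => force_iota (fun t => forces F (scons t s))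
                           (fun t => forces G (scons t s))
  | A => fun Gam => nf Gam (subst s A)
  end.

Lemma forces_atomic A s Gam : atomic A -> forces A s Gam = nf Gam (subst s A).
Proof. by case: A. Qed.

(** An equality of predicates, unlike an equivalence, can be rewritten under [force_all], [force_ex]
    and [force_iota]. *)
Lemma forces_free A s r :
  (forall x, free x A -> s x = r x) -> forces A s = forces A r.
Proof.
elim: A s r => [P ts|t1 t2|t||A IA B IB|A IA B IB|A IA B IB|A IA|A IA|F IF G IG]
  s r E /=.
- apply: functional_extensionality => Gam; congr (nf Gam (Pred P _)).
  apply/ffunP => i; rewrite !ffunE; apply: tsubst_free => x xi.
  by apply: E; exists i.
- by rewrite !(@tsubst_free _ s r) // => x xt; apply: E; [right | left].
- by rewrite (@tsubst_free _ s r).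
- by [].
- by rewrite (IA s r) ?(IB s r) // => x xA; apply: E; [right | left].
- by rewrite (IA s r) ?(IB s r) // => x xA; apply: E; [right | left].
- by rewrite (IA s r) ?(IB s r) // => x xA; apply: E; [right | left].
- by congr force_all; apply: functional_extensionality => t; apply: IA => -[|x] //=;
    apply: E.
- by congr force_ex; apply: functional_extensionality => t; apply: IA => -[|x] //=;
    apply: E.
- congr force_iota; apply: functional_extensionality => t;
    [apply: IF | apply: IG] => -[|x] //= xA; apply: E; [by left | by right].
Qed.

Lemma forces_subst A s r :
  forces (subst r A) s = forces A (fun x => tsubst s (r x)).
Proof.
elim: A s r => [P ts|t1 t2|t||A IA B IB|A IA B IB|A IA B IB|A IA|A IA|F IF G IG]
  s r /=; rewrite ?tsubst_comp ?IA ?IB //.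
- apply: functional_extensionality => Gam; congr (nf Gam (Pred P _)).
  by apply/ffunP => i; rewrite !ffunE tsubst_comp.
- by congr force_all; apply: functional_extensionality => t;
    rewrite IA tsubst_scons_up.
- by congr force_ex; apply: functional_extensionality => t;
    rewrite IA tsubst_scons_up.
- by congr force_iota; apply: functional_extensionality => t;
    rewrite (IF, IG) tsubst_scons_up.
Qed.

Lemma forces_inst A t s : forces (inst A t) s = forces A (scons (tsubst s t) s).
Proof. by rewrite /inst forces_subst tsubst_scons. Qed.

Lemma forces_update A s y t : ~ free y A -> forces A (update s y t) = forces A s.
Proof.
by move=> fr; apply: forces_free => x xA; rewrite /update; case: eqP xA => [->|].
Qed.

(** Eigenvariables are instantiated in the environment, by giving [y] the value [t]. This takes the
    place of substitution into deductions. *)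
Lemma forces_inst_update A s y t :
  ~ free y.+1 A -> forces (inst A (Var y)) (update s y t) = forces A (scons t s).
Proof.
move=> fr; rewrite forces_inst; apply: forces_free => -[|x] /=.
  by rewrite /update eqxx.
by rewrite /update; case: eqP => [->|].
Qed.

Lemma forces_stable A s : stable (forces A s).
Proof.
elim: A s => [P ts|t1 t2|t||A IA B IB|A IA B IB|A IA B IB|A IA|A IA|F IF G IG] s /=;
  try exact: nf_stable.
- by move=> Gam Del sub [/(IA _ _ _ sub) ? /(IB _ _ _ sub)].
- apply: cover_incl => Gam Del sub.
  by case=> [/(IA _ _ _ sub)|/(IB _ _ _ sub)]; [left | right].
- by move=> Gam Del sub H Del' sub'; apply: H; apply: List.incl_tran sub'.
- by move=> Gam Del sub H Del' t sub'; apply: H; apply: List.incl_tran sub'.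
- apply: cover_incl => Gam Del sub [t /(nf_incl sub) ? /(IA _ _ _ sub)].
  by exists t.
- apply: cover_incl => Gam Del sub [t [/(nf_incl sub) ? /(IF _ _ _ sub) ?]].
  move=> /(IG _ _ _ sub) ? uniq; exists t; split=> // Del' t' sub'.
  by apply: uniq; apply: List.incl_tran sub'.
Qed.

(** Atomic formulas rely on [nf_pasting], the clauses defined by [cover] on grafting. For [Imp] and
    [All] the cover is first moved to the extension [Del] and then evaluated leaf by leaf. *)
Lemma forces_pasting A s : pasting (forces A s).
Proof.
elim: A s => [P ts|t1 t2|t||A IA B IB|A IA B IB|A IA B IB|A IA|A IA|F IF G IG] s /=;
  try exact: nf_pasting; try exact: cover_pasting; move=> Gam H.
- split; [apply: IA | apply: IB]; by apply: cover_map H => Del _ [].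
- move=> Del sub fA; apply: IB.
  have H' : cover (force_imp (forces A s) (forces B s)) Del.
    by apply: cover_incl H => //; apply: (@forces_stable (Imp A B)).
  apply: cover_map H' => Del' sub' AB.
  by apply: AB => //; apply: forces_stable fA.
- move=> Del t sub ex; apply: IA.
  have H' : cover (force_all (fun t => forces A (scons t s))) Del.
    by apply: cover_incl H => //; apply: (@forces_stable (All A)).
  apply: cover_map H' => Del' sub' AA.
  by apply: AA => //; apply: nf_incl ex.
Qed.

(** * Reflection of neutral deductions and reification of forced formulas *)

Lemma nf_assume A Gam : List.In A Gam -> nf Gam A.
Proof. by move=> inA; apply/ne_nf/ne_assume. Qed.

(** The two halves depend on each other: reflecting a neutral implication reifies its argument, and
    reifying a forced implication reflects the added assumption. *)
Lemma reflect_reify A s Gam :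
  (ne Gam (subst s A) -> forces A s Gam) /\
  (forces A s Gam -> nf Gam (subst s A)).
Proof.
elim: A s Gam => [P ts|t1 t2|t||A IA B IB|A IA B IB|A IA B IB|A IA|A IA|F IF G IG]
  s Gam /=; try by split=> //; apply: ne_nf.
- split=> [H|[/(proj2 (IA _ _)) ? /(proj2 (IB _ _)) ?]]; last exact: nf_andI.
  by split; [exact: (proj1 (IA _ _) (ne_andE1 H))
               | exact: (proj1 (IB _ _) (ne_andE2 H))].
- split=> [H|H].
    (* The neutral deduction itself is the branching; each disjunct is an assumption at its leaf,
       hence neutral there. *)
    apply: (cover_or H); apply: cover_leaf.
      by left; apply/(proj1 (IA _ _))/ne_assume; left.
    by right; apply/(proj1 (IB _ _))/ne_assume; left.
  apply: nf_pasting; apply: cover_map H => Del _.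
  case=> [/(proj2 (IA _ _))|/(proj2 (IB _ _))].
    exact: nf_orI1.
  exact: nf_orI2.
- split=> [H Del sub /(proj2 (IA _ _)) nA|H].
    by apply/(proj1 (IB _ _))/(ne_impE (ne_incl sub H)).
  apply/nf_impI/(proj2 (IB _ _))/H; first by right.
  by apply/(proj1 (IA _ _))/ne_assume; left.
- split=> [H Del t sub ex|H].
    apply/(proj1 (IA _ _)); rewrite -inst_up; apply: ne_allE => //; exact: ne_incl H.
  (* A fresh variable, assumed to exist, is the generic element at which [H] is evaluated. *)
  have [y _ fr] := fresh_above 0 (All (subst (up s) A) :: Gam).
  apply: (nf_allI fr); rewrite inst_up; apply/(proj2 (IA _ _))/H; first by right.
  by apply: nf_assume; left.
- split=> [H|H].
    apply: (@cover_ex _ _ _ 0 H) => y _; apply: cover_leaf; exists (Var y).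
      by apply: nf_assume; right; left.
    by apply/(proj1 (IA _ _)); rewrite -inst_up; apply: ne_assume; left.
  apply: nf_pasting; apply: cover_map H => Del _ [t ex /(proj2 (IA _ _))].
  by rewrite -inst_up => nA; apply: nf_exI ex.
- split=> [H|H].
    apply: (@cover_iota _ _ _ _ 0 H) => y _; set Gam' := [:: _, _, _ & _].
    have neF : ne Gam' (inst (subst (up s) F) (Var y)) by apply: ne_assume; left.
    have ex : nf Gam' (Exists1 (Var y)) by apply: nf_assume; do 2!right; left.
    apply: cover_leaf; exists (Var y); split=> //.
    + by apply/(proj1 (IF _ _)); rewrite -inst_up.
    + by apply/(proj1 (IG _ _)); rewrite -inst_up; apply: ne_assume; right; left.
    (* Any element satisfying [F] is identified with [y] by [IotaE2], whose major premise is the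
       neutral deduction [H]. *)
    + move=> Del t sub ext /(proj2 (IF _ _)); rewrite -inst_up => nFt.
      apply: (nf_iotaE2 _ ext _ nFt) => //.
      * by apply: ne_incl H => B inB; apply: sub; do 3!right.
      * exact: nf_incl ex.
      * by apply: nf_incl sub _; apply: ne_nf.
  apply: nf_pasting; apply: cover_map H => Del _ [t [ex]].
  move=> /(proj2 (IF _ _)) + /(proj2 (IG _ _));
  rewrite -(inst_up s F) -(inst_up s G) => nF nG uniq.
  (* The last premise of [IotaI] is [uniq] evaluated at a generic [z]. *)
  have [z _ fr] := fresh_above 0
    [:: Iota (subst (up s) F) (subst (up s) G), Exists1 t & Del].
  apply: (nf_iotaI fr nF nG ex); apply: uniq.
  + by do 2!right.
  + by apply: nf_assume; right; left.
  + by apply/(proj1 (IF _ _)); rewrite -inst_up; apply: ne_assume; left.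
Qed.

(** * Soundness of the rules in the model *)

Lemma undischarged_discharge u Ds D v B :
  undischarged D v B -> discharge u Ds (undischarged D) v B \/ List.In B Ds.
Proof.
by move=> uB; have [[]|] := Classical_Prop.classic (v = u /\ List.In B Ds);
  [right | left].
Qed.

(** Assumptions that are not discharged do not contain [y], so they stay forced when its value
    changes; only the formulas in [Ds] are checked at the new value. *)
Lemma forces_eigen u y Ds D s t Gam :
  eigen u y Ds D ->
  (forall v B, discharge u Ds (undischarged D) v B -> forces B s Gam) ->
  (forall B, List.In B Ds -> forces B (update s y t) Gam) ->
  forall v B, undischarged D v B -> forces B (update s y t) Gam.
Proof.
move=> ei fG fD v B /(undischarged_discharge u Ds)[dB|]; last exact: fD.
by rewrite forces_update; [apply: fG dB | apply: ei dB].
Qed.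

Lemma forces_exists_update s y t Gam :
  nf Gam (Exists1 t) -> forces (Exists1 (Var y)) (update s y t) Gam.
Proof. by rewrite /= /update eqxx. Qed.

(** Induction on the tree with environment and context general: eigenvariables change the former,
    extensions in the forcing clauses the latter. For [OrE], [ExE] and [IotaE1] the conclusion is
    forced at each leaf of the cover given by the major premise, then pasted. *)
Lemma soundness D s Gam : correct D ->
  (forall v B, undischarged D v B -> forces B s Gam) -> forces (concl D) s Gam.
Proof.
elim: D s Gam => /=.
- by move=> u A s Gam _; apply.
- move=> D1 IH1 D2 IH2 s Gam [c1 c2] H.
  by split; [apply: IH1 | apply: IH2] => // v B uB; apply: (H v); [left | right].
- by move=> A B D IH s Gam [e c] H; have := IH s Gam c H; rewrite e => -[].
- by move=> A B D IH s Gam [e c] H; have := IH s Gam c H; rewrite e => -[].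
- move=> u A D IH s Gam c H Del sub fA; apply: IH => // v B.
  move=> /(undischarged_discharge u [:: A])[/H|[<-|[]]] //.
  exact: forces_stable.
- move=> A B D IH D1 IH1 s Gam [e e1 c c1] H.
  have := IH s Gam c; rewrite e; apply => //.
    by move=> v C uC; apply: (H v); left.
  by rewrite -e1; apply: IH1 => // v C uC; apply: (H v); right.
- move=> A B D IH s Gam [e c] H; apply: cover_leaf; left.
  by rewrite -e; apply: IH.
- move=> A B D IH s Gam [e c] H; apply: cover_leaf; right.
  by rewrite -e; apply: IH.
- move=> u A B D IH D1 IH1 D2 IH2 s Gam [e e2 c c1 c2] H.
  have := IH s Gam c; rewrite e /= => fAB.
  apply: forces_pasting; apply: cover_map (fAB _) => [Del sub|v C uC]; last first.
    by apply: (H v); apply: Or31.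
  have fG v C : undischarged D v C \/ discharge u [:: A] (undischarged D1) v C \/
      discharge u [:: B] (undischarged D2) v C -> forces C s Del.
    move=> uC; apply: forces_stable sub _; apply: (H v).
    by case: uC => [|[]] uC; [apply: Or31 | apply: Or32 | apply: Or33].
  case=> [fA | fB]; [apply: IH1 | rewrite -e2; apply: IH2] => // v C.
    by case/(undischarged_discharge u [:: A]) => [uC|[<-|[]]] //; eauto.
  by case/(undischarged_discharge u [:: B]) => [uC|[<-|[]]] //; eauto.
(* [Bot] is forced where it has a normal deduction; as [BotE] concludes only atomic formulas, a
   normal [BotE] suffices. *)
- move=> B D IH s Gam [atB e c] H; rewrite forces_atomic //.
  apply: nf_botE; first exact: atomic_subst.
  by have := IH s Gam c H; rewrite e.
- move=> u y A D IH s Gam [e ei fr c] H Del t sub ex.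
  rewrite -(forces_inst_update _ _ fr) -e; apply: IH => //.
  apply: (forces_eigen ei) => [v B uB | B [<-|[]]].
    by apply: forces_stable sub _; apply: H uB.
  exact: forces_exists_update.
- move=> A t D IH D1 IH1 s Gam [e e1 c c1] H.
  rewrite forces_inst; have := IH s Gam c; rewrite e; apply => //.
    by move=> v C uC; apply: (H v); left.
  by have := IH1 s Gam c1; rewrite e1; apply=> v C uC; apply: (H v); right.
- move=> A t D IH D1 IH1 s Gam [e e1 c c1] H.
  apply: cover_leaf; exists (tsubst s t).
    by have := IH1 s Gam c1; rewrite e1; apply=> v C uC; apply: (H v); right.
  by rewrite -forces_inst -e; apply: IH => // v C uC; apply: (H v); left.
- move=> u y A D IH D1 IH1 s Gam [[e c c1] [ei frC frA]] H.
  have fA : forces (Ex A) s Gam.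
    by rewrite -e; apply: IH => // v C uC; apply: (H v); left.
  apply: forces_pasting; apply: cover_map fA => Del sub [t ex fA].
  rewrite -(forces_update s t frC); apply: IH1 => //.
  apply: (forces_eigen ei) => [v B uB | B].
    by apply: forces_stable sub _; apply: (H v); right.
  case=> [<-|[<-|[]]]; last exact: forces_exists_update.
  by rewrite forces_inst_update.
- move=> t D IH s Gam [e c] H; apply: nf_eqI.
  by have := IH s Gam c H; rewrite e.
- move=> A t1 t2 D IH D1 IH1 s Gam [[atA frA _] [e e1 c c1]] H.
  rewrite forces_atomic ?subst_inst; last exact: atomic_subst.
  (* Distinct [t1] and [t2] may coincide once [s] is substituted, a case that [nf_eqE] covers. *)
  apply: (@nf_eqE _ _ _ (tsubst s t1)).
  + exact: atomic_subst.
  + exact: atomic_free_up.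
  + by have := IH s Gam c; rewrite e; apply=> v C uC; apply: (H v); left.
  + rewrite -subst_inst -forces_atomic -?e1; last by rewrite e1; apply: atomic_subst.
    by apply: IH1 => // v C uC; apply: (H v); right.
- move=> P ts i D IH s Gam [e c] H.
  by have := IH s Gam c H; rewrite e /= => /(nf_adpred i); rewrite ffunE.
- move=> t1 t2 D IH s Gam [e c] H.
  by have := IH s Gam c H; rewrite e; apply: nf_adeq1.
- move=> t1 t2 D IH s Gam [e c] H.
  by have := IH s Gam c H; rewrite e; apply: nf_adeq2.
- move=> f ts i D IH s Gam [e c] H.
  by have := IH s Gam c H; rewrite e /= => /(nf_fd i); rewrite ffunE.
- move=> u z F G t D1 IH1 D2 IH2 D3 IH3 D4 IH4 s Gam.
  move=> [[e1 e2 e3 e4] [[c1 c2 c3 c4] [ei frt frF]]] H.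
  apply: cover_leaf; exists (tsubst s t); split.
  + by have := IH3 s Gam c3; rewrite e3; apply=> v C uC; apply: (H v); apply: Or43.
  + by rewrite -forces_inst -e1; apply: IH1 => // v C uC; apply: (H v); apply: Or41.
  + by rewrite -forces_inst -e2; apply: IH2 => // v C uC; apply: (H v); apply: Or42.
  + move=> Del t' sub ex fF.
    have := IH4 (update s z t') Del c4; rewrite e4 /= {2}/update eqxx.
    (* As [z] is not free in [t], the witness stays fixed when [z] takes the value [t']. *)
    rewrite (@tsubst_free _ (update s z t') s t); last first.
      by move=> x xt; rewrite /update; case: eqP xt => [->|].
    apply; apply: (forces_eigen ei) => [v B uB | B].
      by apply: forces_stable sub _; apply: (H v); apply: Or44.
    case=> [<-|[<-|[]]]; last exact: forces_exists_update.
    by rewrite forces_inst_update.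
- move=> u z F G D IH D1 IH1 s Gam [[e c c1] [ei frC frF frG]] H.
  have fI : forces (Iota F G) s Gam.
    by rewrite -e; apply: IH => // v C uC; apply: (H v); left.
  apply: forces_pasting; apply: cover_map fI => Del sub [t [ex fF fG _]].
  rewrite -(forces_update s t frC); apply: IH1 => //.
  apply: (forces_eigen ei) => [v B uB | B].
    by apply: forces_stable sub _; apply: (H v); right.
  case=> [<-|[<-|[<-|[]]]]; last exact: forces_exists_update.
    by rewrite forces_inst_update.
  by rewrite forces_inst_update.
- move=> F G t1 t2 D IH D1 IH1 D2 IH2 D3 IH3 D4 IH4 s Gam.
  move=> [[e e1 e2 e3 e4] [c c1 c2 c3 c4]] H.
  have fI : forces (Iota F G) s Gam.
    by rewrite -e; apply: IH => // v C uC; apply: (H v); left.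
  have ex1 : forces (Exists1 t1) s Gam.
    by rewrite -e1; apply: IH1 => // v C uC; apply: (H v); right; apply: Or41.
  have ex2 : forces (Exists1 t2) s Gam.
    by rewrite -e2; apply: IH2 => // v C uC; apply: (H v); right; apply: Or42.
  have fF1 : forces (inst F t1) s Gam.
    by rewrite -e3; apply: IH3 => // v C uC; apply: (H v); right; apply: Or43.
  have fF2 : forces (inst F t2) s Gam.
    by rewrite -e4; apply: IH4 => // v C uC; apply: (H v); right; apply: Or44.
  (* At each leaf uniqueness identifies both terms with the witness [t]. *)
  apply: nf_pasting; apply: cover_map fI => Del sub [t [_ _ _ uniq]].
  rewrite !forces_inst in fF1 fF2.
  by apply: (@nf_eq_common _ _ _ _ t); apply: uniq => //;
    [exact: nf_incl ex1 | exact: forces_stable fF1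
    |exact: nf_incl ex2 | exact: forces_stable fF2].
Qed.

End Model.

(** * Finiteness of the set of assumptions, and normal form *)

Lemma undischarged_list (L : language) (D : tree L) :
  exists l, forall v B, undischarged D v B -> List.In B l.
Proof.
have app2 (P Q : nat -> form L -> Prop) :
    (exists l, forall v B, P v B -> List.In B l) ->
    (exists l, forall v B, Q v B -> List.In B l) ->
    exists l, forall v B, P v B \/ Q v B -> List.In B l.
  move=> [l Hl] [k Hk]; exists (l ++ k) => v B PQ; apply/List.in_or_app.
  by case: PQ => [/Hl|/Hk]; [left | right].
have sub (P Q : nat -> form L -> Prop) : (forall v B, P v B -> Q v B) ->
    (exists l, forall v B, Q v B -> List.In B l) ->
    exists l, forall v B, P v B -> List.In B l.
  by move=> PQ [l Hl]; exists l => v B /PQ/Hl.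
have dis u Ds (E : tree L) :
    (exists l, forall v B, undischarged E v B -> List.In B l) ->
    exists l, forall v B, discharge u Ds (undischarged E) v B -> List.In B l.
  by apply: sub => v B [].
elim: D => /= [u A|D1 I1 D2 I2|A B D ID|A B D ID|u A D ID|A B D ID D1 I1
  |A B D ID|A B D ID|u A B D ID D1 I1 D2 I2|B D ID|u y A D ID|A t D ID D1 I1
  |A t D ID D1 I1|u y A D ID D1 I1|t D ID|A t1 t2 D ID D1 I1|P ts i D ID
  |t1 t2 D ID|t1 t2 D ID|f ts i D ID|u z F G t D1 I1 D2 I2 D3 I3 D4 I4
  |u z F G D ID D1 I1|F G t1 t2 D ID D1 I1 D2 I2 D3 I3 D4 I4];
  try solve [exact: ID | exact: dis | exact: app2 _ _ ID I1 | exact: app2 _ _ I1 I2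
    | exact: app2 _ _ ID (dis _ _ _ I1)].
- by exists [:: A] => v B [_ ->]; left.
- refine (sub _ _ _ (app2 _ _ ID (app2 _ _ (dis u [:: A] _ I1)
    (dis u [:: B] _ I2)))) => v C [];
    tauto.
- refine (sub _ _ _ (app2 _ _ (app2 _ _ I1 I2)
    (app2 _ _ I3 (dis u [:: inst F (Var z); Exists1 (Var z)] _ I4)))) => v C [];
    tauto.
- refine (sub _ _ _ (app2 _ _ ID (app2 _ _ (app2 _ _ I1 I2) (app2 _ _ I3 I4))))
    => v C;
    by case=> [|[]]; tauto.
Qed.

(** The starting context may hold only assumptions of the given deduction, as the normal one may use
    any of its members. [undischarged_list] gives an upper bound, which is filtered classically. *)
Lemma assumption_list (L : language) (D : tree L) :
  exists l, forall B, List.In B l <-> assumption D B.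
Proof.
have [l Hl] := undischarged_list D.
suff [k Hk] : exists k, forall B,
    List.In B k <-> List.In B l /\ assumption D B.
  exists k => B; split=> [/Hk[]//|[v uB]].
  by apply/Hk; split; [apply: Hl uB | exists v].
elim: l {Hl} => [|A l [k Hk]]; first by exists [::] => B; split=> [|[]].
have [aA|nA] := Classical_Prop.classic (assumption D A).
  exists (A :: k) => B; split=> /= [[<-|/Hk[? ?]]|[[->|? ?]]]; auto.
  by right; apply/Hk.
exists k => B; split=> [/Hk[? ?]|[[<-|? ?]]] //=; first by auto.
by apply/Hk.
Qed.

Theorem theorem1 (L : language) (Gamma : form L -> Prop) (A : form L)
    (Pi : tree L) :
  deduction Gamma A Pi ->
  exists (Delta : form L -> Prop) (Pi' : tree L),
    deduction Delta A Pi' /\ (forall B, Delta B -> Gamma B) /\ normal Pi'.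
Proof.
move=> [cPi <- GammaE]; have [l Hl] := assumption_list Pi.
(* Under the environment [Var] every formula stands for itself: reflection forces the assumptions,
   and reification will read off a deduction of the conclusion. *)
have : forces (concl Pi) Var l.
  apply: soundness => // v B uB; apply: (proj1 (reflect_reify _ _ _)).
  by rewrite subst_id; apply/ne_assume/Hl; exists v.
move/(proj2 (reflect_reify _ _ _)); rewrite subst_id => -[D [cD eD nD uD]].
(* The context only bounds the assumptions of [D], so [Delta] is taken to be those that occur
   undischarged in it. *)
exists (assumption D), D; split; first by split.
split; last exact: neutral_majors_normal.
by move=> B [v /uD[_ /Hl/GammaE]].
Qed.
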